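(* Let $p$ be a prime, let $d \ge 0$ be an integer, and let $X = \mathrm{Cay}(\mathbb{F}_p^d, C)$ be a Cayley graph on $(\mathbb{F}_p^d, +)$ with $\deg(X) \ge p^d - \kappa(p)$. If $V \subseteq \mathbb{F}_p^d$ is an $\mathbb{F}_p$-vector subspace such that the induced subgraph $X|_V$ is a complete core of $X$, then $\dim_{\mathbb{F}_p}(V) \ge d - 2$. Consequently, the core of $X$ has at least $p^{d-2}$ vertices.
   Context: The function $\kappa$ on primes is defined by $\kappa(2) = 5$, $\kappa(3) = 12$, and $\kappa(p) = 2$ for every prime $p \ge 5$. For an abelian group $A$ (written additively), a connection set is a subset $C \subseteq A \setminus \{0\}$ with $-C = C$. The Cayley graph $\mathrm{Cay}(A, C)$ has vertex set $A$, and $x, y \in A$ are adjacent if and only if $x - y \in C$. $\deg(X)$ is the common degree of all vertices of $X$, i.e. $\deg(\mathrm{Cay}(A,C)) = |C|$. For a graph $X$ and $V \subseteq V(X)$, $X|_V$ is the subgraph of $X$ induced by $V$. A graph homomorphism is a map of vertices sending adjacent vertices to adjacent vertices; an endomorphism of a graph is a homomorphism from it to itself. A graph is a core if all its endomorphisms are invertible. A core of a graph $X$ is a subgraph of $X$ that is both a retract of $X$ (i.e. there is a homomorphism from $X$ to the subgraph restricting to the identity on the subgraph) and a core; all cores of a given finite graph are isomorphic, so one speaks of the core of $X$. A complete core of $X$ is a core of $X$ that is a complete graph. *)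

(* Defs.v *)
From HB Require Import structures.
From mathcomp Require Import all_boot all_order all_algebra.

Set Implicit Arguments.
Unset Strict Implicit.
Unset Printing Implicit Defensive.

Import GRing.Theory.

(* Only used at primes. *)
Definition kappa (p : nat) : nat :=
  match p with 2 => 5 | 3 => 12 | _ => 2 end.

(* A finite simple graph whose vertices form a subset of T, so that a graph
   and its subgraphs share the same type. *)
Record graph (T : finType) := Graph {
  verts : {set T};
  adj : rel T;
  adj_verts : forall x y, adj x y -> (x \in verts) && (y \in verts);
  adj_sym : symmetric adj;
  adj_irr : irreflexive adj }.

Section Graphs.

Variable T : finType.
Implicit Types (G H K : graph T) (f g : T -> T) (V : {set T}).

Definition degree G (x : T) : nat := #|[set y | adj G x y]|.

(* Homomorphisms are maps between vertex sets: the values of f outside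
   verts G are irrelevant, and equations between maps are only required on
   vertices. *)
Definition hom G H f : Prop :=
  (forall x, x \in verts G -> f x \in verts H) /\
  (forall x y, adj G x y -> adj H (f x) (f y)).

Definition invertible_endo G f : Prop :=
  exists g, [/\ hom G G g,
    forall x, x \in verts G -> g (f x) = x &
    forall x, x \in verts G -> f (g x) = x].

Definition is_core G : Prop := forall f, hom G G f -> invertible_endo G f.

Definition subgraph H G : Prop :=
  verts H \subset verts G /\ (forall x y, adj H x y -> adj G x y).

Definition retract H G : Prop :=
  subgraph H G /\
  exists f, hom G H f /\ (forall x, x \in verts H -> f x = x).

Definition core_of K G : Prop := retract K G /\ is_core K.

Definition complete G : Prop :=
  forall x y, x \in verts G -> y \in verts G -> x != y -> adj G x y.

Definition complete_core_of K G : Prop := core_of K G /\ complete K.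

Definition induced_adj G V : rel T :=
  fun x y => [&& x \in V, y \in V & adj G x y].

Lemma induced_adj_verts G V x y :
  induced_adj G V x y -> (x \in verts G :&: V) && (y \in verts G :&: V).
Proof.
by case/and3P=> xV yV /adj_verts /andP[xG yG]; rewrite !inE xV yV xG yG.
Qed.

Lemma induced_adj_sym G V : symmetric (induced_adj G V).
Proof. by move=> x y; rewrite /induced_adj adj_sym andbCA. Qed.

Lemma induced_adj_irr G V : irreflexive (induced_adj G V).
Proof. by move=> x; rewrite /induced_adj adj_irr !andbF. Qed.

Definition induced G V : graph T :=
  Graph (@induced_adj_verts G V) (@induced_adj_sym G V) (@induced_adj_irr G V).

End Graphs.

Section Cayley.

Local Open Scope ring_scope.

Variable A : finZmodType.

Definition connection_set (C : {set A}) : Prop :=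
  0 \notin C /\ [set - x | x in C] = C.

Variables (C : {set A}) (hC : connection_set C).

Definition cayley_adj : rel A := fun x y => x - y \in C.

Lemma cayley_adj_verts x y :
  cayley_adj x y -> (x \in [set: A]) && (y \in [set: A]).
Proof. by rewrite !inE. Qed.

Lemma cayley_adj_sym : symmetric cayley_adj.
Proof.
have [_ CN] := hC.
by move=> x y; rewrite /cayley_adj -[in LHS]CN -(opprB y x) mem_imset //; apply: oppr_inj.
Qed.

Lemma cayley_adj_irr : irreflexive cayley_adj.
Proof. by have [/negbTE C0 _] := hC; move=> x; rewrite /cayley_adj subrr. Qed.

Definition cayley : graph A :=
  Graph cayley_adj_verts cayley_adj_sym cayley_adj_irr.

(* All vertices have the same degree, so the degree of the graph may be read
   off at any vertex. *)
Lemma degree_cayley x : degree cayley x = #|C|.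
Proof.
rewrite -(card_imset _ (@subrI _ x)); congr #|pred_of_set _|.
apply/setP=> y; rewrite inE; apply/idP/imsetP => [xyC | [c cC ->]].
  by exists (x - y); rewrite // subKr.
by rewrite /= /cayley_adj subKr.
Qed.

End Cayley.

(* Main.v *)
Require Import Defs.
From HB Require Import structures.
From mathcomp Require Import all_boot all_order all_algebra.
From mathcomp Require Import finfield.

Set Implicit Arguments.
Unset Strict Implicit.
Unset Printing Implicit Defensive.

(** Let [f] retract the Cayley graph [X] on [A] onto its core [K], and let [F]
    be the fiber of [f] over a vertex of [K].  Restricting [f] to a translate
    [K + a] gives an endomorphism of [K], hence a bijection, so every translate
    of [K] meets [F] in exactly one point; summing over all [a] yields
    [|K| * |F| = |A|] (lemma [card_core_fiber]).  On the other hand no two points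
    of [F] are adjacent, as [K] has no loops, so [F] lies in a translate of the
    complement of [C] and [|F| <= |A| - |C|] (lemma [card_fiber_le]).

    For [A] of order [p ^ d] the first fact makes [|F|] a power of [p], and the
    second bounds it by [kappa p < p ^ 3].  Hence [|F| <= p ^ 2], that is,
    [|K| >= p ^ (d - 2)].  This holds for every core; for a core supported on a
    subspace [V] it says [dim V >= d - 2]. *)

Import Order.TTheory GRing.Theory Num.Theory.

Section CayleyCore.

Local Open Scope ring_scope.

Variables (A : finZmodType) (C : {set A}) (hC : connection_set C).
Variables (K : graph A) (f : A -> A).
Hypothesis homf : Defs.hom (cayley hC) K f.

(** Translation by [a] is an automorphism of the Cayley graph, so [f] restricted
    to [K + a] is an endomorphism of [K]; the only point of the fiber there is
    given by its inverse. *)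
Lemma translate_meets_fiber_once (a v : A) :
  subgraph K (cayley hC) -> is_core K -> v \in verts K ->
  #|[set y in verts K | f (y + a) == v]| = 1%N.
Proof.
move=> [_ subK] coreK vK; have [fK fadj] := homf.
have endo : Defs.hom K K (fun y => f (y + a)).
  split=> [x _ | x y /subK xy]; first by apply: fK; rewrite inE.
  by apply: fadj; rewrite /= /cayley_adj opprD addrACA subrr addr0.
have [g [[gK _] gf fg]] := coreK _ endo.
rewrite -(cards1 (g v)); apply: eq_card => y; rewrite !inE.
apply/andP/eqP => [[yK /eqP <-] | ->]; first by rewrite gf.
by rewrite gK ?fg.
Qed.

(** Double counting of the pairs [(a, y)] with [y] in [K] and [f (y + a) = v]. *)
Lemma card_core_fiber (v : A) :
  subgraph K (cayley hC) -> is_core K -> v \in verts K ->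
  (#|verts K| * #|[set x | f x == v]|)%N = #|A|.
Proof.
move=> subK coreK vK.
have <- : (\sum_(a : A) #|[set y in verts K | f (y + a)%R == v]|)%N = #|A|.
  by under eq_bigr do rewrite translate_meets_fiber_once //; rewrite sum1_card.
under eq_bigr do rewrite -sum1dep_card big_mkcondr.
rewrite exchange_big -sum_nat_const; apply: eq_bigr => y _ /=.
rewrite -big_mkcond sum1dep_card -(card_imset _ (@addrI _ y)).
apply: eq_card => x; rewrite inE; apply/idP/imsetP => [fx | [a]].
  by exists (x - y); rewrite ?inE addrC subrK.
by rewrite inE => fa ->.
Qed.

Lemma card_fiber_le (v : A) : (#|[set x | f x == v]| <= #|A| - #|C|)%N.
Proof.
have [_ fadj] := homf.
case: (set_0Vmem [set x | f x == v]) => [-> | [x0]]; first by rewrite cards0.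
rewrite inE => /eqP fx0; rewrite -[C]setCK -cardsCs -(card_imset _ (@subrI _ x0)).
apply/subset_leq_card/subsetP => _ /imsetP[x + ->].
rewrite !inE => /eqP fx; apply/negP => x0xC.
by have := fadj x0 x x0xC; rewrite fx0 fx adj_irr.
Qed.

End CayleyCore.

Lemma kappa_lt_cube (p : nat) : prime p -> kappa p < p ^ 3.
Proof.
by case: p => [|[|[|[|p]]]].
Qed.

Lemma card_core_ge (p : nat) (hp : prime p) (d : nat)
    (C : {set 'rV['F_p]_d}) (hC : connection_set C)
    (hdeg : p ^ d <= degree (cayley hC) 0%R + kappa p)
    (K : graph 'rV['F_p]_d) :
  core_of K (cayley hC) -> p ^ d <= #|verts K| * p ^ 2.
Proof.
move=> [[subK [f [homf _]]] coreK].
have f0K : f 0%R \in verts K by apply: homf.1; rewrite inE.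
have cardA : #|{: 'rV['F_p]_d}| = p ^ d by rewrite card_mx card_Fp ?mul1n.
have := card_core_fiber homf subK coreK f0K.
have := card_fiber_le homf (f 0%R).
rewrite cardA; move: #|[set x | _]| => n n_le Kn.
have n_kappa : n <= kappa p.
  by apply: leq_trans n_le _; rewrite leq_subLR -(degree_cayley hC 0%R).
have [k _ n_pk] : exists2 k, k <= d & n = p ^ k.
  by apply/(dvdn_pfactor _ _ hp); rewrite -Kn dvdn_mull.
rewrite -Kn leq_mul2l n_pk leq_exp2l ?prime_gt1 // -ltnS.
rewrite -(ltn_exp2l _ _ (prime_gt1 hp)) -n_pk.
by rewrite (leq_ltn_trans n_kappa (kappa_lt_cube hp)) orbT.
Qed.

Theorem mainTheorem3 (p : nat) (hp : prime p) (d : nat)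
    (C : {set 'rV['F_p]_d}) (hC : connection_set C)
    (hdeg : p ^ d <= degree (cayley hC) 0%R + kappa p) :
  (forall V : {vspace 'rV['F_p]_d},
     complete_core_of (induced (cayley hC) [set x in V]) (cayley hC) ->
     d <= \dim V + 2) /\
  (forall K : graph 'rV['F_p]_d, core_of K (cayley hC) ->
     ((p%:R : rat) ^ (d%:Z - 2%:Z) <= #|verts K|%:R)%R).
Proof.
split=> [V [coreV _] | K coreK].
  have := card_core_ge hp hdeg coreV.
  rewrite /= setTI cardsE card_vspace card_Fp // -expnD.
  by rewrite leq_exp2l ?prime_gt1.
have p_gt0 : (0 < p%:R :> rat)%R by rewrite ltr0n prime_gt0.
rewrite expfzDr ?gt_eqF // -exprnN ler_pdivrMr ?exprn_gt0 //.
rewrite -exprnP -!natrX -natrM ler_nat.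
exact (card_core_ge hp hdeg coreK).
Qed.
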